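(* (i) For $n=3$ and for $n=4$: for all functions $f:\mathbb{R}\to\mathbb{R}$ and points $x\in\mathbb{R}$, if both $f_{(n-2)}^s(x)$ and $D_n^sf(x)$ exist, then $f_{(n)}^s(x)$ exists. (ii) For each $n\in\{5,6,7,8\}$: the existence of both $f_{(n-2)}^s(x)$ and $D_n^sf(x)$ does not imply the existence of $f_{(n)}^s(x)$ for all $f$ and $x$; that is, there exist a function $f:\mathbb{R}\to\mathbb{R}$ and a point $x\in\mathbb{R}$ such that $f_{(n-2)}^s(x)$ and $D_n^sf(x)$ both exist but $f_{(n)}^s(x)$ does not exist.
   Context: The $n$-th symmetric Riemann derivative of $f$ at $x$ is $D_n^sf(x)=\lim_{h\to 0}\frac1{h^n}\sum_{k=0}^n(-1)^k\binom nk f\left(x+\left(\frac n2-k\right)h\right)$, when this limit exists as a finite real number. $f$ has $n$ symmetric Peano derivatives at $x$ (equivalently, the $n$-th symmetric Peano derivative $f_{(n)}^s(x)$ exists) if there are real numbers $f_{(0)}^s(x),\ldots ,f_{(n)}^s(x)$, with $f_{(0)}^s(x)=f(x)$ when $n$ is even, such that $\frac12\{f(x+h)+(-1)^nf(x-h)\}=\sum_{i=0}^n f_{(i)}^s(x)\frac{h^i}{i!}+o(h^n)$ as $h\to 0$. *)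

(* Defs.v *)
From mathcomp Require Import all_boot all_order all_algebra.
From mathcomp Require Import all_classical all_reals all_analysis.

Set Implicit Arguments.
Unset Strict Implicit.
Unset Printing Implicit Defensive.

Import Order.TTheory GRing.Theory Num.Theory.
Import numFieldNormedType.Exports.

Local Open Scope classical_set_scope.
Local Open Scope ring_scope.

Definition sym_riemann_quotient (R : realType) (f : R -> R) (n : nat) (x h : R)
  : R :=
  (h ^+ n)^-1 *
  \sum_(k < n.+1)
    (-1) ^+ k * 'C(n, k)%:R * f (x + (n%:R / 2 - k%:R) * h).

Definition is_sym_riemann_derivative
    (R : realType) (f : R -> R) (n : nat) (x l : R) : Prop :=
  sym_riemann_quotient f n x h @[h --> 0^'] --> l.

Definition ex_sym_riemann_derivative
    (R : realType) (f : R -> R) (n : nat) (x : R) : Prop :=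
  exists l : R, is_sym_riemann_derivative f n x l.

(* Only [c 0, ..., c n] matter: [c i] is the i-th symmetric Peano derivative.
   Filtering by punctured neighbourhoods loses nothing at h = 0: for even n
   both sides are [f x] there, and for odd n the left-hand side is an odd
   function of h, which forces [c 0 = 0]. *)
Definition are_sym_peano_derivatives
    (R : realType) (f : R -> R) (n : nat) (x : R) (c : nat -> R) : Prop :=
  (~~ odd n -> c 0%N = f x) /\
  (fun h : R => 2^-1 * (f (x + h) + (-1) ^+ n * f (x - h))) =
    (fun h : R => \sum_(i < n.+1) c i * (h ^+ i / i`!%:R))
      +o_ (0^') (fun h : R => h ^+ n).

Definition ex_sym_peano_derivative
    (R : realType) (f : R -> R) (n : nat) (x : R) : Prop :=
  exists c : nat -> R, are_sym_peano_derivatives f n x c.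

(* Main.v *)
Require Import Defs.
From mathcomp Require Import all_boot all_order all_algebra.
From mathcomp Require Import all_classical all_reals all_analysis.
From mathcomp Require Import ring lra.

(** Only the part of [f] around [x] of the parity of [n] matters.

    For [n = 3, 4], after subtraction of the candidate polynomial, the [n]-th
    symmetric difference involves only two scales and reads
    [u(a t) - a^(n-2) u(t) = o(t^n)] with [a = 3], resp. [a = 2]. Together with
    [u = o(t^(n-2))], telescoping along [t, t/a, t/a^2, ...] gives
    [u = o(t^n)].

    For [n = 5, ..., 8], let [chi] be a multiplicative function on the positive
    rationals with values in [{1, -1}], determined by its values on the primes,
    and let [f t = chi |t| |t|^s] for rational [t], [f t = 0] for irrational
    [t], times the sign of [t] if [n] is odd. Since [f (m t) = chi m m^s f t],
    the symmetric differences of [f] at 0 vanish identically as soon as [s] is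
    a root of an exponential sum, e.g.
    [chi 5 5^s - 5 chi 3 3^s + 10 = 0] for [n = 5]. For [chi = 1] the roots
    include [n - 2], but flipping [chi] on suitable primes moves a root inside
    the interval between [n - 2] and [n]. Then [f = o(t^(n-2))]; and if [f] were
    a polynomial up to [o(t^n)], it would be [o(t^n)], because
    [f (m t) = - m^s f t] for some [m]: this contradicts [s <= n]. *)

Import Order.TTheory GRing.Theory Num.Theory.
Import numFieldNormedType.Exports.

Local Open Scope classical_set_scope.
Local Open Scope ring_scope.

(** * Little-o of powers at 0, and its behaviour under dilations *)

Section little_o_powers.
Context {R : realType}.
Implicit Types (u v : R -> R) (a t : R) (n : nat).

Definition o_pow n u : Prop :=
  forall e : R, 0 < e -> exists2 d : R, 0 < d &
    forall t, t != 0 -> `|t| < d -> `|u t| <= e * `|t| ^+ n.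

Lemma o_pow_ext n u v : u =1 v -> o_pow n u -> o_pow n v.
Proof. by move=> /funext ->. Qed.

Lemma o_powD n u v : o_pow n u -> o_pow n v -> o_pow n (fun t => u t + v t).
Proof.
move=> ou ov e e0; have e20 : 0 < e / 2 by rewrite divr_gt0.
have [d1 d10 hu] := ou _ e20; have [d2 d20 hv] := ov _ e20.
exists (Num.min d1 d2); first by rewrite lt_min d10.
move=> t t0; rewrite lt_min => /andP[td1 td2].
rewrite (le_trans (ler_normD _ _))// (splitr e) mulrDl lerD ?hu ?hv//.
Qed.

Lemma o_powZ n k u : o_pow n u -> o_pow n (fun t => k * u t).
Proof.
(* Dividing by [|k| + 1] instead of [|k|] covers [k = 0]. *)
move=> ou e e0; have k0 : 0 < `|k| + 1 by rewrite ltr_wpDl.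
have [d d0 hu] := ou _ (divr_gt0 e0 k0); exists d => // t t0 td.
rewrite normrM; apply: le_trans (_ : (`|k| + 1) * `|u t| <= _).
  by rewrite ler_wpM2r ?lerDl.
by rewrite -ler_pdivlMl// mulrA [_^-1 * _]mulrC hu.
Qed.

Lemma o_pow_dilate n a u : a != 0 -> o_pow n u -> o_pow n (fun t => u (a * t)).
Proof.
move=> a0 ou e e0; have na0 : 0 < `|a| by rewrite normr_gt0.
have [d d0 hu] := ou _ (divr_gt0 e0 (exprn_gt0 n na0)).
exists (d / `|a|); first exact: divr_gt0.
move=> t t0; rewrite ltr_pdivlMr// mulrC -normrM => atd.
rewrite (le_trans (hu _ _ atd)) ?mulf_neq0// normrM exprMn mulrA divfK//.
by rewrite expf_neq0// gt_eqF.
Qed.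

Lemma o_pow_monomial (n m : nat) : (n < m)%N -> o_pow n (fun t => t ^+ m).
Proof.
move=> nm e e0; exists (Num.min e 1); first by rewrite lt_min e0 ltr01.
move=> t t0; rewrite lt_min => /andP[/ltW te /ltW t1].
rewrite normrX -(subnK nm) addnS -addSn exprD ler_wpM2r ?exprn_ge0//.
by rewrite exprSr (le_trans _ te)// ler_piMl// exprn_ile1.
Qed.

Lemma o_pow_littleo n (f g : R -> R) :
  f = g +o_ (0^') (fun h : R => h ^+ n) <-> o_pow n (fun h => f h - g h).
Proof.
rewrite eqaddoP; split => H e /[dup] e0 /H.
- rewrite /dnbhs /within /= => /nbhs_ballP[d /= d0 dH]; exists d => // t t0 td.
  rewrite -normrX; apply: (dH t) => //.
  by rewrite /ball /= sub0r normrN.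
- move=> [d d0 dH]; rewrite /dnbhs /within /=; apply/nbhs_ballP.
  exists d => //= t; rewrite /ball /= sub0r normrN => td t0.
  by rewrite normrX dH.
Qed.

Lemma o_pow_cvg n (S : R -> R) (l : R) :
  (h ^+ n)^-1 * S h @[h --> 0^'] --> l -> o_pow n (fun h => S h - l * h ^+ n).
Proof.
move=> /cvgrPdist_le H e /H; rewrite /dnbhs /within /=.
move=> /nbhs_ballP[d /= d0 dH]; exists d => // t t0 td.
have := dH t; rewrite /ball /= sub0r normrN => /(_ td t0) h.
have tn0 : t ^+ n != 0 by rewrite expf_neq0.
have -> : S t - l * t ^+ n = - (l - (t ^+ n)^-1 * S t) * t ^+ n.
  by field.
by rewrite normrM normrN normrX ler_wpM2r// exprn_ge0.
Qed.

(* With [v = |u| / t^p], the dilation hypothesis says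
   [v(a t) <= v(t) + e |t|^(n-p)], so a multiple [k] of [e |t|^(n-p)] can be
   subtracted from [v] to make it nonincreasing along [t, t/a, t/a^2, ...],
   where it tends to 0. *)
Lemma o_pow_dilation_gain (p n : nat) a u : 1 < a -> (p < n)%N ->
  o_pow p u -> o_pow n (fun t => u (a * t) - a ^+ p * u t) -> o_pow n u.
Proof.
move=> a1 pn up un e e0; have a0 : 0 < a by apply: lt_trans a1.
have an0 m : 0 < a ^+ m by rewrite exprn_gt0.
pose q := (n - p)%N.
have nE : n = (p + q)%N by rewrite subnKC// ltnW.
have aq : 0 < a ^+ q - 1 by rewrite subr_gt0 exprn_egt1// subn_eq0 -ltnNge.
(* With this tolerance the subtracted term is exactly [e * |s| ^+ q]: passing from [s] to [a * s]
   adds [e * (a ^+ q - 1) * |s| ^+ q] to it. *)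
have e'0 : 0 < e * a ^+ p * (a ^+ q - 1) by rewrite !mulr_gt0.
have [d d0 dH] := un _ e'0; exists d => // t t0 td.
pose w s := `|u s| / `|s| ^+ p - e * `|s| ^+ q.
have wa s : s != 0 -> `|s| < d -> w (a * s) <= w s.
  move=> s0 sd; have := dH _ s0 sd.
  have ns0 : 0 < `|s| by rewrite normr_gt0.
  have sp0 : 0 < `|s| ^+ p by rewrite exprn_gt0.
  rewrite /w normrM gtr0_norm// !exprMn nE exprD => H0.
  have H : `|u (a * s)| <= a ^+ p * `|u s| +
     e * a ^+ p * (a ^+ q - 1) * (`|s| ^+ p * `|s| ^+ q).
    have := lerB_dist (u (a * s)) (a ^+ p * u s).
    rewrite [`|a ^+ p * _|]normrM [`|a ^+ p|]gtr0_norm// => H1.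
    by rewrite -lerBlDl (le_trans H1).
  rewrite lerBlDr ler_pdivrMr ?mulr_gt0//; apply: (le_trans H).
  rewrite le_eqVlt; apply/orP; left; apply/eqP.
  by field; rewrite gt_eqF.
have wn k : w t <= w (t / a ^+ k).
  elim: k => [|k IH]; first by rewrite expr0 divr1.
  apply: (le_trans IH).
  have -> : t / a ^+ k = a * (t / a ^+ k.+1).
    by rewrite exprS; field; rewrite !gt_eqF.
  apply: wa; first by rewrite mulf_neq0// invr_eq0 gt_eqF.
  rewrite normrM normfV [`|a ^+ _|]gtr0_norm//.
  rewrite (le_lt_trans _ td)// ler_piMr// invf_le1//.
  by rewrite exprn_ege1// ltW.
(* [w t] is bounded by every [w (t / a ^+ k)], and [u = o(t^p)] brings one of these below any given
   [eta]. *)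
have w0 : w t <= 0.
  apply/ler_addgt0Pr => eta eta0; rewrite add0r.
  have [d' d'0 d'H] := up _ eta0.
  have [k kt] : exists k : nat, `|t / a ^+ k| < d'.
    pose b := a^-1.
    have b01 : `|b| < 1 by rewrite normfV gtr0_norm// invf_lt1.
    have /cvgrPdist_lt/(_ d' d'0) := cvg_geometric t b01.
    move=> [k _ /(_ k (leqnn k))]; rewrite /= sub0r normrN /b exprVn => H.
    by exists k.
  have tk0 : t / a ^+ k != 0 by rewrite mulf_neq0// invr_eq0 gt_eqF.
  apply: (le_trans (wn k)); rewrite /w lerBlDr.
  have ntk : 0 < `|t / a ^+ k| by rewrite normr_gt0.
  rewrite (@le_trans _ _ eta)//.
    by rewrite ler_pdivrMr ?exprn_gt0// d'H.
  by rewrite lerDl mulr_ge0 ?exprn_ge0// ltW.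
have tp0 : 0 < `|t| ^+ p by rewrite exprn_gt0// normr_gt0.
move: w0; rewrite /w subr_le0 ler_pdivrMr// nE exprD.
by rewrite -mulrA [X in e * X]mulrC.
Qed.

(* The dilation [t |-> m t] followed by subtraction of [m^k] times the original
   kills the monomial [t^k] but only rescales [u], by [- (m^s + m^k)]. *)
Lemma o_pow_poly_negative_dilation (n k : nat) (m M : R) (c : nat -> R) u :
  0 < m -> 0 < M -> (forall t, u (m * t) = - M * u t) ->
  o_pow n (fun t => u t - \sum_(i < k) c i * t ^+ i) -> o_pow n u.
Proof.
move=> m0 M0 uM; elim: k c => [|k IH] c H.
  by apply: o_pow_ext H => t; rewrite big_ord0 subr0.
have P0 : 0 < M + m ^+ k by rewrite addr_gt0// exprn_gt0.
(* The dilated combination turns [u] into [- (M + m ^+ k) * u]; these are its coefficients after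
   dividing by that factor. *)
pose c' i := (m ^+ i - m ^+ k) * c i * (- (M + m ^+ k))^-1.
apply: (IH c').
have := o_powD n _ _ (o_pow_dilate _ _ _ (lt0r_neq0 m0) H)
                     (o_powZ n (- m ^+ k) _ H).
move=> /(o_powZ n (- (M + m ^+ k))^-1); apply: o_pow_ext => t.
rewrite uM !big_ord_recr /= exprMn.
have -> : \sum_(i < k) c' i * t ^+ i = (- (M + m ^+ k))^-1 *
   (\sum_(i < k) c i * (m * t) ^+ i - m ^+ k * \sum_(i < k) c i * t ^+ i).
  rewrite mulr_sumr -sumrB mulr_sumr; apply: eq_bigr => i _.
  by rewrite /c' exprMn; ring.
by field; rewrite gt_eqF.
Qed.

End little_o_powers.

(** * The positive results for orders 3 and 4 *)

Section third_and_fourth_order.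
Context {R : realType}.
Implicit Types (f : R -> R) (x : R).

Lemma ex_sym_peano_derivative3 f x :
  ex_sym_peano_derivative f 1 x -> ex_sym_riemann_derivative f 3 x ->
  ex_sym_peano_derivative f 3 x.
Proof.
move=> [c [_ /o_pow_littleo Hc]] [L /o_pow_cvg HL].
pose g h := 2^-1 * (f (x + h) - f (x - h)).
pose u h := g h - c 1%N * h - L / 6 * h ^+ 3.
have n2 : (2 : R) != 0 by rewrite pnatr_eq0.
have nN1 : (-1 : R) != 0 by rewrite oppr_eq0 oner_eq0.
(* Taking the odd part of the expansion removes [c 0]. *)
have g1 : o_pow 1 (fun h => g h - c 1%N * h).
  have := o_powD _ _ _ Hc (o_powZ _ (-1) _ (o_pow_dilate _ _ _ nN1 Hc)).
  move=> /(o_powZ _ 2^-1); apply: o_pow_ext => h.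
  rewrite /g !big_ord_recr !big_ord0 /= !factS !fact0.
  rewrite !mulN1r opprK ?expr1 ?expr0.
  by field.
have u1 : o_pow 1 u.
  have := o_powD _ _ _ g1 (o_powZ _ (- (L / 6)) _ (o_pow_monomial 1 3 isT)).
  by apply: o_pow_ext => h; rewrite /u mulNr.
have n3 : (1 : R) < 3 by rewrite ltr1n.
have u3 : o_pow 3 u.
  apply: (@o_pow_dilation_gain _ 1 3 3 u n3 isT u1).
  (* With step [2 * t] the nodes are [x ± 3t] and [x ± t], and half the difference is
     [g (3t) - 3 g t]. The cubic terms agree because [(27 - 3) / 6 = 2^3 / 2]. *)
  have := o_powZ _ 2^-1 _ (o_pow_dilate _ _ _ n2 HL).
  apply: o_pow_ext => t; rewrite /u /g !big_ord_recr big_ord0 /=.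
  rewrite bin0 bin1 binn (_ : 'C(3, 2) = 3)%N//.
  rewrite (_ : x + (3 / 2 - 0%:R) * (2 * t) = x + 3 * t); last by field.
  rewrite (_ : x + (3 / 2 - 1) * (2 * t) = x + t); last by field.
  rewrite (_ : x + (3 / 2 - 2) * (2 * t) = x - t); last by field.
  rewrite (_ : x + (3 / 2 - 3) * (2 * t) = x - 3 * t); last by field.
  by field.
exists (fun i => if i == 1 then c 1%N else if i == 3 then L else 0%R)%N.
split=> //; apply/o_pow_littleo; apply: o_pow_ext u3 => h.
rewrite /u /g !big_ord_recr big_ord0 /= !factS fact0.
by field.
Qed.

Lemma ex_sym_peano_derivative4 f x :
  ex_sym_peano_derivative f 2 x -> ex_sym_riemann_derivative f 4 x ->
  ex_sym_peano_derivative f 4 x.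
Proof.
move=> [c [/(_ isT) c0 /o_pow_littleo Hc]] [L /o_pow_cvg HL].
pose g h := 2^-1 * (f (x + h) + f (x - h)).
pose u h := g h - f x - c 2%N / 2 * h ^+ 2 - L / 24 * h ^+ 4.
have nN1 : (-1 : R) != 0 by rewrite oppr_eq0 oner_eq0.
(* Taking the even part removes [c 1]; the constant term is [f x] by evenness of the order. *)
have g2 : o_pow 2 (fun h => g h - f x - c 2%N / 2 * h ^+ 2).
  have := o_powD _ _ _ Hc (o_pow_dilate _ _ _ nN1 Hc).
  move=> /(o_powZ _ 2^-1); apply: o_pow_ext => h.
  rewrite /g !big_ord_recr !big_ord0 /= !factS !fact0 c0.
  rewrite !mulN1r opprK ?expr1 ?expr0.
  by field.
have u2 : o_pow 2 u.
  have := o_powD _ _ _ g2 (o_powZ _ (- (L / 24)) _ (o_pow_monomial 2 4 isT)).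
  by apply: o_pow_ext => h; rewrite /u mulNr.
have n2 : (1 : R) < 2 by rewrite ltr1n.
have u4 : o_pow 4 u.
  apply: (@o_pow_dilation_gain _ 2 4 2 u n2 isT u2).
  (* Half the difference is [g (2t) - 4 g t + 3 f x]. The central term absorbs the constants of [u],
     and the quartic terms agree because [(16 - 4) / 24 = 1 / 2]. *)
  have := o_powZ _ 2^-1 _ HL.
  apply: o_pow_ext => t; rewrite /u /g !big_ord_recr big_ord0 /=.
  rewrite bin0 bin1 binn (_ : 'C(4, 2) = 6)%N// (_ : 'C(4, 3) = 4)%N//.
  rewrite (_ : x + (4 / 2 - 0%:R) * t = x + 2 * t); last by field.
  rewrite (_ : x + (4 / 2 - 1) * t = x + t); last by field.
  rewrite (_ : x + (4 / 2 - 2) * t = x); last by field.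
  rewrite (_ : x + (4 / 2 - 3) * t = x - t); last by field.
  rewrite (_ : x + (4 / 2 - 4) * t = x - 2 * t); last by field.
  by field.
exists (fun i => if i == 0 then f x else if i == 2 then c 2%N
                 else if i == 4 then L else 0%R)%N.
split=> //; apply/o_pow_littleo; apply: o_pow_ext u4 => h.
rewrite /u /g !big_ord_recr big_ord0 /= !factS fact0.
by field.
Qed.

End third_and_fourth_order.

(** * Powers twisted by a multiplicative sign on the rationals *)

Section signed_power.
Context {R : realType}.
Implicit Types (S : seq nat) (m n : nat) (r : rat) (s t : R).

(** [S] lists the primes at which [chi] is -1, so that [chi m] is -1 to this power. *)
Definition total_logn S m : nat := \sum_(p <- S) logn p m.

Lemma total_lognM S m n : (0 < m)%N -> (0 < n)%N ->
  total_logn S (m * n) = (total_logn S m + total_logn S n)%N.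
Proof.
by move=> m0 n0; rewrite -big_split; apply: eq_bigr => p _; rewrite lognM.
Qed.

(** This is [chi |r|], extended by 0 at 0. The exponents of numerator and denominator are added, not
    subtracted, as only the parity counts. *)
Definition rat_sign S r : R :=
  (r != 0)%:R * (-1) ^+ (total_logn S `|numq r| + total_logn S `|denq r|).

Lemma rat_signN S r : rat_sign S (- r) = rat_sign S r.
Proof. by rewrite /rat_sign oppr_eq0 numqN denqN abszN. Qed.

(** The fraction [m * r] may need reduction, so the parities are compared in the cross-multiplied
    integer identity, where nothing cancels. *)
Lemma rat_sign_natM S m r : (0 < m)%N ->
  rat_sign S (m%:R * r) = (-1) ^+ total_logn S m * rat_sign S r.
Proof.
move=> m0; have [->|r0] := eqVneq r 0;
  first by rewrite mulr0 /rat_sign eqxx !mul0r mulr0.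
have mr0 : m%:R * r != 0 by rewrite mulf_neq0// pnatr_eq0 -lt0n.
rewrite /rat_sign mr0 r0 !mul1r -exprD.
set r' := m%:R * r in mr0 *.
have /(congr1 absz) : numq r' * denq r = m%:Z * numq r * denq r'.
  apply: (@intr_inj rat); rewrite !intrM !numqE /r'.
  rewrite -pmulrn; set d := (denq r)%:~R; set d' := (denq _)%:~R; ring.
rewrite !abszM absz_nat => /(congr1 (total_logn S)).
have num0 q : q != 0 -> (0 < `|numq q|)%N by rewrite absz_gt0 numq_eq0.
have den0 q : (0 < `|denq q|)%N by rewrite absz_gt0 denq_neq0.
rewrite !total_lognM ?muln_gt0 ?m0 ?num0 ?den0// => /(congr1 odd).
move=> E; rewrite -signr_odd -[in RHS]signr_odd; congr (_ ^+ nat_of_bool _).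
move: E; rewrite !oddD; by do 5 case: (odd _).
Qed.

(* Extended by 0 to the irrationals, on which [xget] returns the default 0. *)
Definition real_sign S t : R := rat_sign S (xget 0 [set r | ratr r = t]).

Lemma real_sign_ratr S r : real_sign S (ratr r) = rat_sign S r.
Proof.
rewrite /real_sign; case: xgetP => [q _ /= /fmorph_inj ->//|/(_ r)].
by move=> /(_ erefl).
Qed.

Lemma real_sign_irrational S t : (forall r, ratr r <> t) -> real_sign S t = 0.
Proof.
move=> H; rewrite /real_sign; case: xgetP => [q _ /= /H//|_].
by rewrite /rat_sign eqxx mul0r.
Qed.

Lemma real_sign_natM S m t : (0 < m)%N ->
  real_sign S (m%:R * t) = (-1) ^+ total_logn S m * real_sign S t.
Proof.
move=> m0; have [[r <-]|H] := pselect (exists r, ratr r = t).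
  have -> : m%:R * ratr r = ratr (m%:R * r) :> R by rewrite rmorphM rmorph_nat.
  by rewrite !real_sign_ratr rat_sign_natM.
rewrite !real_sign_irrational ?mulr0// => r rE; apply: H; first by exists r.
exists (r / m%:R); rewrite rmorphM fmorphV rmorph_nat /= rE.
by rewrite mulrC mulKf// pnatr_eq0 -lt0n.
Qed.

Lemma real_signN S t : real_sign S (- t) = real_sign S t.
Proof.
have [[r <-]|H] := pselect (exists r, ratr r = t).
  by rewrite -rmorphN !real_sign_ratr rat_signN.
rewrite !real_sign_irrational// => r rE; apply: H; first by exists r.
by exists (- r); rewrite rmorphN /= rE opprK.
Qed.

Lemma normr_real_sign_le1 S t : `|real_sign S t| <= 1.
Proof.
by rewrite /real_sign /rat_sign normrM normr_sign mulr1; case: (_ != _);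
  rewrite ?normr0 ?normr1.
Qed.

Lemma normr_real_sign_invn S m : `|real_sign S (m.+1%:R^-1)| = 1.
Proof.
rewrite -[m.+1%:R](@ratr_nat R) -fmorphV real_sign_ratr /rat_sign.
by rewrite normrM normr_sign mulr1 invr_eq0 pnatr_eq0 normr1.
Qed.

Definition signed_pow S n s t : R := Num.sg t ^+ n * real_sign S t * `|t| `^ s.

Lemma signed_pow_natM S n s m t : (0 < m)%N ->
  signed_pow S n s (m%:R * t) =
  (-1) ^+ total_logn S m * m%:R `^ s * signed_pow S n s t.
Proof.
move=> m0; rewrite /signed_pow real_sign_natM// normrM powRM// sgrM.
by rewrite gtr0_sg ?ltr0n// mul1r normr_nat; ring.
Qed.

Lemma signed_powN S n s t :
  signed_pow S n s (- t) = (-1) ^+ n * signed_pow S n s t.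
Proof. by rewrite /signed_pow real_signN normrN sgrN [in LHS]exprNn !mulrA. Qed.

Lemma signed_pow0 S n s : signed_pow S n s 0 = 0.
Proof.
have := real_sign_ratr S 0; rewrite rmorph0 => S0.
by rewrite /signed_pow S0 /rat_sign eqxx !(mul0r, mulr0).
Qed.

Lemma o_pow_signed_pow S n s p : p%:R < s -> o_pow p (signed_pow S n s).
Proof.
move=> ps e e0; have q0 : 0 < s - p%:R by rewrite subr_gt0.
(* This radius [d] solves [d^(s - p) = e], which bounds the first factor of
   [|t|^s = |t|^(s - p) |t|^p]. *)
exists (e `^ (s - p%:R)^-1); first exact: powR_gt0.
move=> t t0 td; have nt0 : `|t| != 0 by rewrite normr_eq0.
apply: le_trans (_ : `|t| `^ s <= _).
  rewrite /signed_pow 2!normrM (ger0_norm (powR_ge0 _ _)).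
  rewrite -[leRHS]mul1r ler_wpM2r ?powR_ge0// normrX normr_sg t0 expr1n mul1r.
  exact: normr_real_sign_le1.
rewrite -[s in `|t| `^ s](subrK p%:R) powRD ?nt0 ?implybT// powR_mulrn//.
rewrite ler_wpM2r ?exprn_ge0//.
have /(@ge0_ler_powR _ (s - p%:R)) := ltW td.
rewrite -powRrM mulVf ?gt_eqF// powRr1 ?(ltW e0)//; apply.
- exact: ltW.
- by rewrite nnegrE.
- by rewrite nnegrE powR_ge0.
Qed.

(** At the reciprocals of positive integers, which tend to 0, the function has modulus [t^s >= t^n],
    against the bound [t^n / 2]. *)
Lemma not_o_pow_signed_pow S n s : s <= n%:R -> ~ o_pow n (signed_pow S n s).
Proof.
move=> sn /(_ 2^-1); rewrite invr_gt0 ltr0n => /(_ isT)[d d0 dH].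
have [k kd] : exists k : nat, k.+1%:R^-1 < d.
  have /cvgrPdist_lt/(_ d d0)[k _ /(_ k (leqnn k))] := @cvg_harmonic R.
  by rewrite sub0r normrN ger0_norm//= => kd; exists k.
have t0 : 0 < k.+1%:R^-1 :> R by rewrite invr_gt0 ltr0n.
move: (dH k.+1%:R^-1); rewrite gt_eqF// gtr0_norm// => /(_ isT kd).
rewrite /signed_pow 2!normrM normr_real_sign_invn gtr0_sg// expr1n normr1.
rewrite !mul1r.
rewrite [`|_^-1|]gtr0_norm// (ger0_norm (powR_ge0 _ _)) leNgt => /negP; apply.
rewrite -powR_mulrn ?(ltW t0)//.
apply: (@lt_le_trans _ _ (k.+1%:R^-1 `^ n%:R)).
  by rewrite gtr_pMl ?powR_gt0// invf_lt1// ltr1n.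
by apply: ger_powR => //; rewrite t0 invf_le1 ?ltr0n// ler1n.
Qed.

Lemma signed_pow_counterexample S n m s :
  (2 <= n)%N -> (0 < m)%N -> odd (total_logn S m) ->
  (n - 2)%:R < s <= n%:R ->
  (forall h, \sum_(k < n.+1) (-1) ^+ k * 'C(n, k)%:R *
     signed_pow S n s ((n%:R / 2 - k%:R) * h) = 0) ->
  exists (f : R -> R) (x : R),
    [/\ ex_sym_peano_derivative f (n - 2)%N x,
        ex_sym_riemann_derivative f n x
      & ~ ex_sym_peano_derivative f n x].
Proof.
move=> n2 m0 odd_m /andP[ns sn] sum0; pose f := signed_pow S n s.
(* [f] has the parity of [n], hence of [n - 2], so it is its own symmetrised part in both Peano
   expansions. *)
have fE h : 2^-1 * (f (0 + h) + (-1) ^+ n * f (0 - h)) = f h.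
  rewrite add0r sub0r /f signed_powN mulrA -exprD -signr_odd addnn odd_double.
  by field.
exists f, 0; split.
- exists (fun=> 0); split; first by rewrite /f signed_pow0.
  apply/o_pow_littleo; apply: o_pow_ext (o_pow_signed_pow S n s _ ns) => h.
  rewrite big1 ?subr0 => [|i _]; last by rewrite mul0r.
  by rewrite -signr_odd oddB//= addbF signr_odd fE.
- exists 0; rewrite /is_sym_riemann_derivative /sym_riemann_quotient.
  under eq_fun do under eq_bigr do rewrite add0r.
  by under eq_fun do rewrite sum0 mulr0; exact: cvg_cst.
move=> [c [_ /o_pow_littleo H]]; apply: (not_o_pow_signed_pow S n s sn).
have Mp : 0 < m%:R `^ s :> R by rewrite powR_gt0 ?ltr0n.
have mp : 0 < m%:R :> R by rewrite ltr0n.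
apply: (@o_pow_poly_negative_dilation _ n n.+1 _ _
  (fun i => c i / i`!%:R) _ mp Mp).
  by move=> t; rewrite signed_pow_natM// -signr_odd odd_m mulN1r.
apply: o_pow_ext H => h; rewrite fE; congr (_ - _).
by apply: eq_bigr => i _; rewrite mulrAC mulrA.
Qed.

(** Intermediate value theorem. The root must avoid [a], since with [a = n - 2] the function is to
    be [o(t^(n-2))]. *)
Lemma exponential_sum_root (a b : R) (F : seq (R * nat)) :
  all (fun p => (0 < p.2)%N) F -> a <= b ->
  \sum_(p <- F) p.1 * p.2%:R `^ a < 0 -> 0 < \sum_(p <- F) p.1 * p.2%:R `^ b ->
  exists2 s, a < s <= b & \sum_(p <- F) p.1 * p.2%:R `^ s = 0.
Proof.
move=> F0 ab Fa Fb; pose G s := \sum_(p <- F) p.1 * p.2%:R `^ s.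
have cG : continuous G.
  rewrite /G; elim: F F0 {Fa Fb G} => [_|p F IH /= /andP[p0 F0]].
    by under eq_fun do rewrite big_nil; move=> s; exact: cvg_cst.
  under eq_fun do rewrite big_cons.
  move=> s; apply: cvgD; last exact: IH.
  apply: cvgM; first exact: cvg_cst.
  (* A nonzero base selects the branch [expR (s * ln p.2)] of [powR]. *)
  rewrite /powR pnatr_eq0 gtn_eqF//.
  apply: (continuous_comp (f := fun s => s * ln p.2%:R)).
    by apply: continuousM => //; exact: cvg_cst.
  exact: continuous_expR.
have [|s sab Gs] := @IVT _ G a b 0 ab (continuous_subspaceT cG).
  by rewrite ge_min le_max (ltW Fa) (ltW Fb) orbT.
exists s => //; move: sab; rewrite in_itv /= => /andP[as_ ->].
rewrite andbT lt_neqAle as_ andbT; apply: contraTneq Fa => ->.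
by rewrite -[X in X < 0]/(G s) Gs ltxx.
Qed.

End signed_power.

(** * The counterexamples for orders 5 to 8 *)

Section counterexamples.
Context {R : realType}.

(* [chi] is -1 at 3 and 5; the equation is multiplied by -1. *)
Lemma counterexample5 : exists (f : R -> R) (x : R),
  [/\ ex_sym_peano_derivative f 3 x, ex_sym_riemann_derivative f 5 x
    & ~ ex_sym_peano_derivative f 5 x].
Proof.
have [||||s s35] :=
  @exponential_sum_root R 3 5 [:: (1, 5%N); (- 5, 3%N); (- 10, 1%N)].
- by [].
- by rewrite ler_nat.
- by rewrite !big_cons big_nil /= !powR_mulrn//; lra.
- by rewrite !big_cons big_nil /= !powR_mulrn//; lra.
rewrite !big_cons big_nil /= powR1 => root.
have e3 : total_logn [:: 3; 5]%N 3 = 1%N by rewrite /total_logn unlock.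
have e5 : total_logn [:: 3; 5]%N 5 = 1%N by rewrite /total_logn unlock.
apply: (@signed_pow_counterexample _ [:: 3; 5]%N 5 3 s); rewrite ?e3// => h.
rewrite !big_ord_recr big_ord0 /= bin0 bin1 binn.
rewrite (_ : 'C(5, 2) = 10)%N// (_ : 'C(5, 3) = 10)%N// (_ : 'C(5, 4) = 5)%N//.
rewrite (_ : (5 / 2 - 0%:R) * h = 5 * (h / 2)); last by field.
rewrite (_ : (5 / 2 - 1) * h = 3 * (h / 2)); last by field.
rewrite (_ : (5 / 2 - 2) * h = h / 2); last by field.
rewrite (_ : (5 / 2 - 3) * h = - (h / 2)); last by field.
rewrite (_ : (5 / 2 - 4) * h = - (3 * (h / 2))); last by field.
rewrite (_ : (5 / 2 - 5) * h = - (5 * (h / 2))); last by field.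
rewrite !signed_powN !signed_pow_natM// e3 e5.
set y := signed_pow _ _ _ _.
(* Oddness pairs the nodes [±h/2, ±3h/2, ±5h/2], which gives a factor 2; the minus sign undoes the
   sign change of the equation. *)
rewrite -[RHS](mulr0 (-2 * y)) -[in RHS]root.
by field.
Qed.


(** [chi] is -1 at 2 and 3, and [chi 3 3^s - 6 chi 2 2^s + 15 = 0] is again multiplied by -1. The
    central node contributes nothing, as the function vanishes at 0. *)
Lemma counterexample6 : exists (f : R -> R) (x : R),
  [/\ ex_sym_peano_derivative f 4 x, ex_sym_riemann_derivative f 6 x
    & ~ ex_sym_peano_derivative f 6 x].
Proof.
have [||||s s46] := @exponential_sum_root R 4 6
  [:: (1, 3%N); (- 6, 2%N); (- 15, 1%N)].
- by [].
- by rewrite ler_nat.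
- by rewrite !big_cons big_nil /= !powR_mulrn//; lra.
- by rewrite !big_cons big_nil /= !powR_mulrn//; lra.
rewrite !big_cons big_nil /= powR1 => root.
have e2 : total_logn [:: 2; 3]%N 2 = 1%N by rewrite /total_logn unlock.
have e3 : total_logn [:: 2; 3]%N 3 = 1%N by rewrite /total_logn unlock.
apply: (@signed_pow_counterexample _ [:: 2; 3]%N 6 2 s); rewrite ?e2// => h.
rewrite !big_ord_recr big_ord0 /= bin0 bin1 binn.
rewrite (_ : 'C(6, 2) = 15)%N// (_ : 'C(6, 3) = 20)%N// (_ : 'C(6, 4) = 15)%N//.
rewrite (_ : 'C(6, 5) = 6)%N//.
rewrite (_ : (6 / 2 - 0%:R) * h = 3 * h); last by field.
rewrite (_ : (6 / 2 - 1) * h = 2 * h); last by field.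
rewrite (_ : (6 / 2 - 2) * h = h); last by field.
rewrite (_ : (6 / 2 - 3) * h = 0); last by field.
rewrite (_ : (6 / 2 - 4) * h = - h); last by field.
rewrite (_ : (6 / 2 - 5) * h = - (2 * h)); last by field.
rewrite (_ : (6 / 2 - 6) * h = - (3 * h)); last by field.
rewrite !signed_powN signed_pow0 !signed_pow_natM// e2 e3.
set y := signed_pow _ _ _ _.
rewrite -[RHS](mulr0 (-2 * y)) -[in RHS]root.
by field.
Qed.

(** Flipping [chi] at 3 alone reverses the term [21 * 3^s] of [7^s - 7 * 5^s + 21 * 3^s - 35], which
    makes the sum negative at 5 and leaves it positive at 7. *)
Lemma counterexample7 : exists (f : R -> R) (x : R),
  [/\ ex_sym_peano_derivative f 5 x, ex_sym_riemann_derivative f 7 x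
    & ~ ex_sym_peano_derivative f 7 x].
Proof.
have [||||s s57] := @exponential_sum_root R 5 7
  [:: (1, 7%N); (- 7, 5%N); (- 21, 3%N); (- 35, 1%N)].
- by [].
- by rewrite ler_nat.
- by rewrite !big_cons big_nil /= !powR_mulrn//; lra.
- by rewrite !big_cons big_nil /= !powR_mulrn//; lra.
rewrite !big_cons big_nil /= powR1 => root.
have e3 : total_logn [:: 3]%N 3 = 1%N by rewrite /total_logn unlock.
have e5 : total_logn [:: 3]%N 5 = 0%N by rewrite /total_logn unlock.
have e7 : total_logn [:: 3]%N 7 = 0%N by rewrite /total_logn unlock.
apply: (@signed_pow_counterexample _ [:: 3]%N 7 3 s); rewrite ?e3// => h.
rewrite !big_ord_recr big_ord0 /= bin0 bin1 binn.
rewrite (_ : 'C(7, 2) = 21)%N// (_ : 'C(7, 3) = 35)%N// (_ : 'C(7, 4) = 35)%N//.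
rewrite (_ : 'C(7, 5) = 21)%N// (_ : 'C(7, 6) = 7)%N//.
rewrite (_ : (7 / 2 - 0%:R) * h = 7 * (h / 2)); last by field.
rewrite (_ : (7 / 2 - 1) * h = 5 * (h / 2)); last by field.
rewrite (_ : (7 / 2 - 2) * h = 3 * (h / 2)); last by field.
rewrite (_ : (7 / 2 - 3) * h = h / 2); last by field.
rewrite (_ : (7 / 2 - 4) * h = - (h / 2)); last by field.
rewrite (_ : (7 / 2 - 5) * h = - (3 * (h / 2))); last by field.
rewrite (_ : (7 / 2 - 6) * h = - (5 * (h / 2))); last by field.
rewrite (_ : (7 / 2 - 7) * h = - (7 * (h / 2))); last by field.
rewrite !signed_powN !signed_pow_natM// e3 e5 e7.
set y := signed_pow _ _ _ _.
rewrite -[RHS](mulr0 (2 * y)) -[in RHS]root.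
by field.
Qed.

(** Flipping [chi] at 2 alone reverses the term [28 * 2^s] of [4^s - 8 * 3^s + 28 * 2^s - 56], while
    [chi 4 = (chi 2)^2 = 1] keeps the leading term. *)
Lemma counterexample8 : exists (f : R -> R) (x : R),
  [/\ ex_sym_peano_derivative f 6 x, ex_sym_riemann_derivative f 8 x
    & ~ ex_sym_peano_derivative f 8 x].
Proof.
have [||||s s68] := @exponential_sum_root R 6 8
  [:: (1, 4%N); (- 8, 3%N); (- 28, 2%N); (- 56, 1%N)].
- by [].
- by rewrite ler_nat.
- by rewrite !big_cons big_nil /= !powR_mulrn//; lra.
- by rewrite !big_cons big_nil /= !powR_mulrn//; lra.
rewrite !big_cons big_nil /= powR1 => root.
have e2 : total_logn [:: 2]%N 2 = 1%N by rewrite /total_logn unlock.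
have e3 : total_logn [:: 2]%N 3 = 0%N by rewrite /total_logn unlock.
have e4 : total_logn [:: 2]%N 4 = 2%N by rewrite /total_logn unlock.
apply: (@signed_pow_counterexample _ [:: 2]%N 8 2 s); rewrite ?e2// => h.
rewrite !big_ord_recr big_ord0 /= bin0 bin1 binn.
rewrite (_ : 'C(8, 2) = 28)%N// (_ : 'C(8, 3) = 56)%N// (_ : 'C(8, 4) = 70)%N//.
rewrite (_ : 'C(8, 5) = 56)%N// (_ : 'C(8, 6) = 28)%N// (_ : 'C(8, 7) = 8)%N//.
rewrite (_ : (8 / 2 - 0%:R) * h = 4 * h); last by field.
rewrite (_ : (8 / 2 - 1) * h = 3 * h); last by field.
rewrite (_ : (8 / 2 - 2) * h = 2 * h); last by field.
rewrite (_ : (8 / 2 - 3) * h = h); last by field.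
rewrite (_ : (8 / 2 - 4) * h = 0); last by field.
rewrite (_ : (8 / 2 - 5) * h = - h); last by field.
rewrite (_ : (8 / 2 - 6) * h = - (2 * h)); last by field.
rewrite (_ : (8 / 2 - 7) * h = - (3 * h)); last by field.
rewrite (_ : (8 / 2 - 8) * h = - (4 * h)); last by field.
rewrite !signed_powN signed_pow0 !signed_pow_natM// e2 e3 e4.
set y := signed_pow _ _ _ _.
rewrite -[RHS](mulr0 (2 * y)) -[in RHS]root.
by field.
Qed.

End counterexamples.

Theorem theorem3p2 (R : realType) :
  (forall n : nat, n = 3%N \/ n = 4%N ->
     forall (f : R -> R) (x : R),
       ex_sym_peano_derivative f (n - 2)%N x ->
       ex_sym_riemann_derivative f n x ->
       ex_sym_peano_derivative f n x)
  /\
  (forall n : nat, n = 5%N \/ n = 6%N \/ n = 7%N \/ n = 8%N ->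
     exists (f : R -> R) (x : R),
       [/\ ex_sym_peano_derivative f (n - 2)%N x,
           ex_sym_riemann_derivative f n x
         & ~ ex_sym_peano_derivative f n x]).
Proof.
split=> [n [->|->] f x|n [->|[->|[->|->]]]].
- exact: ex_sym_peano_derivative3.
- exact: ex_sym_peano_derivative4.
- exact: counterexample5.
- exact: counterexample6.
- exact: counterexample7.
- exact: counterexample8.
Qed.
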